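(* Let $x_1,x_2,\ldots$ be iid $\mathcal{N}(\theta,\sigma^2)$ observations (with $\sigma>0$ fixed), and let the prior distribution of $\theta$ be the standard normal distribution $\mathcal{N}(0,1)$ on $\Theta=\mathbb{R}$. Let $\psi_{\theta_0,\theta_1}(n)=\mathbb{E}_{\theta_1}[q_n^{\theta_0}]$. (i) For every real $\theta$ and $n\geq1$ we have $$\psi_{\theta,\theta}(n)=\frac{n+\sigma^2}{\sigma\sqrt{2\pi(2n+\sigma^2)}}\exp\left(-\frac{\theta^2\sigma^2}{4n+2\sigma^2}\right),$$ and thus $$\psi_{\theta_0,\theta_1}(n)=\exp\left(\frac{\theta^2-\theta_0^2}{2}\right)\psi_{\theta,\theta}(n)\exp\left(-\frac{n(\theta_0-\theta_1)^2}{4\sigma^2}\right)$$ for every real $\theta_0$ and $\theta_1$ with $(\theta_0+\theta_1)/2=\theta$. (ii) There is $n_0\geq0$ that depends on $\sigma$ and $\theta$ such that the sequence $\psi_{\theta,\theta}(n)$ is strictly log-convex for $n<n_0$ and strictly log-concave for $n>n_0$, and thus so are the sequences $\psi_{\theta_0,\theta_1}(n)$ for every $\theta_0,\theta_1$ with $(\theta_0+\theta_1)/2=\theta$. (iii) When $\sigma^2\leq\sqrt{2}$ or $|\theta|\geq1/2$ the sequence $\psi_{\theta,\theta}(n)$ is strictly log-concave for $n\geq1$. (iv) For every $\theta_1\neq\theta_0$ the sequence $\psi_{\theta_0,\theta_1}(n)$ has at most two critical points, and so it is of one of three types: always decreasing; increasing and then decreasing; decreasing, increasing, and then decreasing.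
   Context: For $s_n=(x_1,\ldots,x_n)\in\mathbb{R}^n$ let $p_\theta(s_n)=\prod_{i=1}^n\frac{1}{\sqrt{2\pi}\,\sigma}e^{-(x_i-\theta)^2/(2\sigma^2)}$, let $\varphi(\theta)=\frac{1}{\sqrt{2\pi}}e^{-\theta^2/2}$ be the prior density (here $\pi=3.14159\ldots$), and let $p(s_n)=\int_{\mathbb{R}}p_\theta(s_n)\varphi(\theta)\,\mathrm{d}\theta$. The posterior density at $\theta_0$ is $q_n^{\theta_0}(s_n)=p_{\theta_0}(s_n)\varphi(\theta_0)/p(s_n)$, and $$\psi_{\theta_0,\theta_1}(n)=\mathbb{E}_{\theta_1}[q_n^{\theta_0}]=\int_{\mathbb{R}^n}q_n^{\theta_0}(s_n)\,p_{\theta_1}(s_n)\,\mathrm{d}s_n.$$ A sequence of positive numbers $\psi(n)$ is strictly log-concave (respectively strictly log-convex) on a range of indices if $\psi(n)^2>\psi(n-1)\psi(n+1)$ (respectively $<$) whenever $n-1,n,n+1$ all lie in that range. In (iv), ''critical points'' refers to the expression for $\psi_{\theta_0,\theta_1}(n)$ in (i) viewed as a differentiable function of a real variable $n>0$. ''Increasing'' and ''decreasing'' are in the weak sense. *)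

(* Defs.v *)
From HB Require Import structures.
From mathcomp Require Import all_boot all_order all_algebra.
From mathcomp Require Import all_classical all_reals all_analysis.

Set Implicit Arguments.
Unset Strict Implicit.
Unset Printing Implicit Defensive.

Import Order.TTheory GRing.Theory Num.Theory.
Import numFieldNormedType.Exports.

Local Open Scope classical_set_scope.
Local Open Scope ring_scope.

Section cons_measure.
Context d (T : measurableType d) (R : realType) (n : nat).
Variables (mu : {sigma_finite_measure set T -> \bar R})
          (nu : {sigma_finite_measure set (n.-tuple T) -> \bar R}).

Definition tuple_cons (p : T * n.-tuple T) : n.+1.-tuple T :=
  [tuple of p.1 :: p.2].

Lemma measurable_tuple_cons : measurable_fun [set: T * n.-tuple T] tuple_cons.
Proof. exact: (measurable_cons measurable_fst measurable_snd). Qed.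

(* The product measure mu \x nu, carried over to n.+1.-tuple T along the
   identification of T * n.-tuple T with n.+1.-tuple T. *)
Definition cons_measure : set (n.+1.-tuple T) -> \bar R :=
  pushforward (mu \x nu)%E tuple_cons.

Let mtc : {mfun (T * n.-tuple T)%type >-> n.+1.-tuple T} :=
  HB.pack tuple_cons (isMeasurableFun.Build _ _ _ _ _ measurable_tuple_cons).

Let cons_measure0 : cons_measure set0 = 0%E.
Proof. exact: (measure0 (pushforward (mu \x nu)%E mtc)). Qed.

Let cons_measure_ge0 A : (0 <= cons_measure A)%E.
Proof. exact: (measure_ge0 (pushforward (mu \x nu)%E mtc)). Qed.

Let cons_measure_sigma_additive : semi_sigma_additive cons_measure.
Proof.
exact: (@measure_semi_sigma_additive _ _ _ (pushforward (mu \x nu)%E mtc)).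
Qed.

HB.instance Definition _ := isMeasure.Build _ _ _ cons_measure
  cons_measure0 cons_measure_ge0 cons_measure_sigma_additive.

Let cons_measure_sigma_finite : sigma_finite setT cons_measure.
Proof.
have [F [FT Fnd Foo]] := (sigma_finiteP setT mu).1 (sigma_finiteT mu).
have [G [GT Gnd Goo]] := (sigma_finiteP setT nu).1 (sigma_finiteT nu).
pose uncons (t : n.+1.-tuple T) : T * n.-tuple T :=
  (thead t, [tuple of behead t]).
have unconsK : cancel tuple_cons uncons.
  by move=> [x t]; rewrite /uncons /tuple_cons /=; congr (_, _); exact/val_inj.
have muncons : measurable_fun [set: n.+1.-tuple T] uncons.
  apply/measurable_fun_pairP; split.
  - exact: (@measurable_tnth _ T n.+1 ord0).
  - exact: measurable_behead.
exists (fun i => uncons @^-1` (F i `*` G i)).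
  apply/esym; rewrite -subTset => t _.
  have [i _ Fi] : (\bigcup_i F i) (thead t) by rewrite -FT.
  have [j _ Gj] : (\bigcup_i G i) [tuple of behead t] by rewrite -GT.
  exists (maxn i j) => //; split => /=.
  - by move: Fi; exact/subsetPset/Fnd/leq_maxl.
  - by move: Gj; exact/subsetPset/Gnd/leq_maxr.
move=> i; have [[mF Fi] [mG Gi]] := (Foo i, Goo i); split.
  by rewrite -[X in measurable X]setTI; apply: muncons => //;
    exact: measurableX.
rewrite /cons_measure /pushforward (_ : _ @^-1` _ = F i `*` G i).
  by rewrite product_measure1E// lte_mul_pinfty// ge0_fin_numE.
by rewrite -comp_preimage (_ : _ \o _ = id)//; exact/funext/unconsK.
Qed.

HB.instance Definition _ := Measure_isSigmaFinite.Build _ _ _ cons_measure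
  cons_measure_sigma_finite.

End cons_measure.

(* n-dimensional Lebesgue measure, R^n being n.-tuple R *)
Fixpoint lebesgue_tuple (R : realType) (n : nat) :
    {sigma_finite_measure set (n.-tuple (measurableTypeR R)) -> \bar R} :=
  match n with
  | 0 => \d_([tuple] : 0.-tuple (measurableTypeR R))
  | m.+1 => cons_measure (@lebesgue_measure R) (lebesgue_tuple R m)
  end.

Section posterior.
Context {R : realType}.
Implicit Types (sigma theta : R) (n : nat).

Definition likelihood sigma n theta (s : n.-tuple (measurableTypeR R)) : R :=
  \prod_(i < n) normal_pdf theta sigma (tnth s i).

Definition prior_pdf theta : R := normal_pdf 0 1 theta.

Definition marginal_pdf sigma n (s : n.-tuple (measurableTypeR R)) : R :=
  \int[@lebesgue_measure R]_theta
    (likelihood sigma theta s * prior_pdf theta).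

Definition posterior_pdf sigma n theta0
    (s : n.-tuple (measurableTypeR R)) : R :=
  likelihood sigma theta0 s * prior_pdf theta0 / marginal_pdf sigma s.

Definition psi sigma theta0 theta1 n : R :=
  \int[lebesgue_tuple R n]_s
    (posterior_pdf sigma theta0 s * likelihood sigma theta1 s).

Definition psi_diag_expr sigma theta (t : R) : R :=
  (t + sigma ^+ 2) / (sigma * Num.sqrt (2 * pi * (2 * t + sigma ^+ 2))) *
  expR (- (theta ^+ 2 * sigma ^+ 2 / (4 * t + 2 * sigma ^+ 2))).

(* The closed form of psi sigma theta0 theta1 n, with the index n replaced by
   a real variable t. *)
Definition psi_expr sigma theta0 theta1 (t : R) : R :=
  let theta := (theta0 + theta1) / 2 in
  expR ((theta ^+ 2 - theta0 ^+ 2) / 2) * psi_diag_expr sigma theta t *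
  expR (- (t * (theta0 - theta1) ^+ 2 / (4 * sigma ^+ 2))).

End posterior.

Section sequences_on.
Context {R : realType}.
Implicit Types (I : set nat) (u : nat -> R).

(* The index set I is meant to be an interval; the inequality is required only
   when all three consecutive indices lie in I. *)
Definition strictly_log_concave_on I u : Prop :=
  (forall n, I n -> 0 < u n) /\
  (forall n, I n -> I n.+1 -> I n.+2 -> u n * u n.+2 < u n.+1 ^+ 2).

Definition strictly_log_convex_on I u : Prop :=
  (forall n, I n -> 0 < u n) /\
  (forall n, I n -> I n.+1 -> I n.+2 -> u n.+1 ^+ 2 < u n * u n.+2).

Definition increasing_on I u : Prop :=
  {in I &, {homo u : m n / (m <= n)%N >-> m <= n}}.

Definition decreasing_on I u : Prop :=
  {in I &, {homo u : m n / (m <= n)%N >-> n <= m}}.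

End sequences_on.

(* Main.v *)
Require Import Defs.
From mathcomp Require Import all_boot all_order all_algebra.
From mathcomp Require Import all_classical all_reals all_analysis.
From mathcomp Require Import measurable_realfun ring lra.

Import Order.TTheory GRing.Theory Num.Theory.
Import numFieldNormedType.Exports.

Local Open Scope classical_set_scope.
Local Open Scope card_scope.
Local Open Scope ring_scope.

(** The closed form. Write a for sigma ^+ 2 and S for the sum of the
    observations. As a function of theta the likelihood is, up to a factor that
    does not involve theta, exp (theta S / a - n theta^2 / (2 a)); integrating
    it against the normal prior (integral_exp_quad_normal) shows that the posterior
    density at theta0 is a constant times
    exp ((theta0 / a) S - S^2 / (2 a (n + a))), a function of S alone
    (posterior_pdfE). Its mean under theta1 is therefore a Gaussian integral,
    because S is a sum of independent normal variables. Rather than the law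
    of S, integral_exp_quad_likelihood computes the mean of
    exp (b S - r S^2 / 2) by induction on n: integrating out one observation
    turns this exponential of a quadratic into another one, with new r and b.
    The result is psiE: psi is psi_expr at every natural number.

    The shape. Since psi_expr is positive, everything is read off its
    logarithmic derivative
    F(t) = 1/(t+a) - 1/(2t+a) + theta^2 a / (2t+a)^2 - c,
    where theta is the mean of theta0 and theta1 and
    c = (theta0-theta1)^2 / (4a) does not affect monotonicity. The sign of F'
    is that of the cubic
    (a^2 - 2 t^2)(2 t + a) - 4 theta^2 a (t+a)^2,
    whose coefficients change sign at most once (the signs of the two low-order
    ones are that of 1 - 4 theta^2). By Descartes' rule there is thus t0 >= 0,
    depending only on a and theta, with F increasing before t0 and decreasing
    after it (score_unimodal). Second differences of ln psi are differences of
    values of F at two ordered points, by the mean value theorem, so psi is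
    log-convex before t0 and log-concave after it. If theta^2 >= 1/4, the cubic
    is negative on t > 0, and if a^2 <= 2 it is negative on t > 1, which is all
    that log-concavity from index 1 on needs.

    When theta1 <> theta0, the zeros of F are the critical points, and F has
    at most one on each side of t0. Moreover F never takes a positive, then a
    negative, then a positive value, so psi cannot rise, then fall, then rise
    again; as F tends to - c < 0, psi falls in the end. These two facts leave
    the three listed types (no_rise_fall_rise_type). *)

(** * Gaussian integrals of exponentials of quadratics *)

Section gauss.
Context {R : realType}.
Implicit Types (r b m s v w x : R).

Definition exp_quad r b x : R := expR (b * x - r * x ^+ 2 / 2).

(** The mean of exp_quad r b under the normal law with mean m and
    variance v. *)
Definition gauss_exp_quad r b m v : R :=
  (Num.sqrt (1 + r * v))^-1 *
  expR ((v * b ^+ 2 / 2 + b * m - r * m ^+ 2 / 2) / (1 + r * v)).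

Lemma normal_pdf_expE m s x : 0 < s -> normal_pdf m s x =
  (Num.sqrt (2 * pi * s ^+ 2))^-1 * expR (- (x - m) ^+ 2 / (2 * s ^+ 2)).
Proof.
move=> s0; rewrite normal_pdfE ?gt_eqF// /normal_peak /normal_fun.
by congr ((Num.sqrt _)^-1 * expR (_ / _)); rewrite -[LHS]mulr_natl; ring.
Qed.

(** Completing the square: tilting a normal density by exp_quad r b gives a
    multiple of another normal density. *)
Lemma exp_quad_normal_pdf r b m s x : 0 <= r -> 0 < s ->
  exp_quad r b x * normal_pdf m s x =
  gauss_exp_quad r b m (s ^+ 2) *
  normal_pdf ((m + b * s ^+ 2) / (1 + r * s ^+ 2))
             (s / Num.sqrt (1 + r * s ^+ 2)) x.
Proof.
move=> r0 s0.
have k0 : 0 < 1 + r * s ^+ 2.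
  by rewrite ltr_pwDl// mulr_ge0// sqr_ge0.
have q0 : 0 < Num.sqrt (1 + r * s ^+ 2) by rewrite sqrtr_gt0.
have qE : Num.sqrt (1 + r * s ^+ 2) ^+ 2 = 1 + r * s ^+ 2.
  by rewrite sqr_sqrtr// ltW.
rewrite !normal_pdf_expE ?divr_gt0//.
rewrite /exp_quad /gauss_exp_quad exprMn exprVn qE.
have p0 : 0 <= 2 * pi * s ^+ 2 :> R.
  by rewrite mulr_ge0 ?sqr_ge0// mulr_ge0// pi_ge0.
have -> : Num.sqrt (2 * pi * (s ^+ 2 / (1 + r * s ^+ 2))) =
    Num.sqrt (2 * pi * s ^+ 2) / Num.sqrt (1 + r * s ^+ 2).
  by rewrite mulrA sqrtrM// sqrtrV// ltW.
rewrite [(_ / Num.sqrt _)^-1]invf_div.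
rewrite mulrCA -expRD.
rewrite [RHS](_ : _ = (Num.sqrt (2 * pi * s ^+ 2))^-1 * (expR
    ((s ^+ 2 * b ^+ 2 / 2 + b * m - r * m ^+ 2 / 2) / (1 + r * s ^+ 2)) *
    expR (- (x - (m + b * s ^+ 2) / (1 + r * s ^+ 2)) ^+ 2 /
           (2 * (s ^+ 2 / (1 + r * s ^+ 2)))))).
  rewrite -expRD; congr (_ * expR _); field.
  by rewrite gt_eqF//= gt_eqF.
set A := (Num.sqrt (2 * _ * _))^-1; set q := Num.sqrt _ in q0 *.
by field; rewrite gt_eqF.
Qed.

Lemma gauss_exp_quad_ge0 r b m v : 0 <= gauss_exp_quad r b m v.
Proof. by rewrite mulr_ge0 ?expR_ge0// invr_ge0 sqrtr_ge0. Qed.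

Lemma integral_exp_quad_normal r b m s : 0 <= r -> 0 < s ->
  (\int[@lebesgue_measure R]_x (exp_quad r b x * normal_pdf m s x)%:E =
   (gauss_exp_quad r b m (s ^+ 2))%:E)%E.
Proof.
move=> r0 s0.
under eq_integral do rewrite exp_quad_normal_pdf// EFinM.
rewrite ge0_integralZl//=.
- by rewrite integral_normal_pdf mule1.
- by apply/measurable_EFinP; exact: measurable_normal_pdf.
- by move=> x _; rewrite lee_fin normal_pdf_ge0.
- by rewrite lee_fin gauss_exp_quad_ge0.
Qed.

(** Up to a factor free of x, a shift by w only changes the linear coefficient,
    so that w can be a parameter while x is integrated out. *)
Lemma exp_quadD r b x w :
  exp_quad r b (x + w) = exp_quad r b w * exp_quad r (b - r * w) x.
Proof. by rewrite /exp_quad -expRD; congr expR; field. Qed.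

(** What remains of exp_quad r b (x + w) once the normal variable x has been
    integrated out is again exp_quad, now in w. *)
Lemma exp_quad_gauss r b m v w : 0 <= r -> 0 <= v ->
  exp_quad r b w * gauss_exp_quad r (b - r * w) m v =
  gauss_exp_quad r b m v *
  exp_quad (r / (1 + r * v)) ((b - r * m) / (1 + r * v)) w.
Proof.
move=> r0 v0.
have k0 : 0 < 1 + r * v by rewrite ltr_pwDl// mulr_ge0.
rewrite /exp_quad /gauss_exp_quad mulrCA -!mulrA -!expRD.
by congr (_ * expR _); field; rewrite gt_eqF.
Qed.

(** Integrating out two independent normal variables in turn amounts to
    integrating out their sum, of mean m1 + m2 and variance v1 + v2. *)
Lemma gauss_exp_quad_conv r b m1 v1 m2 v2 : 0 <= r -> 0 <= v1 -> 0 <= v2 ->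
  gauss_exp_quad r b m1 v1 *
  gauss_exp_quad (r / (1 + r * v1)) ((b - r * m1) / (1 + r * v1)) m2 v2 =
  gauss_exp_quad r b (m1 + m2) (v1 + v2).
Proof.
move=> r0 v10 v20.
have k0 : 0 < 1 + r * v1 by rewrite ltr_pwDl// mulr_ge0.
have l0 : 0 < 1 + r * (v1 + v2) by rewrite ltr_pwDl// mulr_ge0// addr_ge0.
have kl : 1 + r / (1 + r * v1) * v2 = (1 + r * (v1 + v2)) / (1 + r * v1).
  by field; rewrite gt_eqF.
rewrite /gauss_exp_quad kl mulrACA -expRD -invfM -sqrtrM ?ltW//.
congr ((Num.sqrt _)^-1 * expR _); first by field; rewrite gt_eqF.
by field; rewrite !gt_eqF.
Qed.

End gauss.

(** * Exponentials of quadratics in the sum of the observations *)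

Section likelihood_integral.
Context {R : realType}.
Implicit Types (sigma theta r b m v : R) (n : nat).
Local Notation tupleR n := (n.-tuple (measurableTypeR R)).

Definition tuple_sum {n} (s : tupleR n) : R := \sum_(i < n) tnth s i.

Lemma tuple_sum_cons n x (s : tupleR n) :
  tuple_sum (tuple_cons (x, s)) = x + tuple_sum s.
Proof.
rewrite /tuple_sum big_ord_recl tnth0; congr (_ + _).
by apply: eq_bigr => i _; rewrite tnthS.
Qed.

Lemma likelihood_cons sigma theta n x (s : tupleR n) :
  likelihood sigma theta (tuple_cons (x, s)) =
  normal_pdf theta sigma x * likelihood sigma theta s.
Proof.
rewrite /likelihood big_ord_recl tnth0; congr (_ * _).
by apply: eq_bigr => i _; rewrite tnthS.
Qed.

Lemma measurable_tuple_sum n : measurable_fun [set: tupleR n] (@tuple_sum n).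
Proof.
apply: (@measurable_sum _ (tupleR n) R setT _ (index_enum 'I_n)
  (fun (i : 'I_n) (s : tupleR n) => tnth s i : R)) => i.
exact: measurable_tnth.
Qed.

Lemma measurable_likelihood sigma n theta :
  measurable_fun [set: tupleR n] (@likelihood R sigma n theta).
Proof.
apply: (@measurable_prod _ (tupleR n) R setT _ (index_enum 'I_n)
  (fun (i : 'I_n) (s : tupleR n) => normal_pdf theta sigma (tnth s i))) => i _.
exact: (measurableT_comp (measurable_normal_pdf theta sigma)
          (@measurable_tnth _ (measurableTypeR R) n i)).
Qed.

Lemma likelihood_ge0 sigma n theta s : 0 <= @likelihood R sigma n theta s.
Proof. by apply: prodr_ge0 => i _; exact: normal_pdf_ge0. Qed.

Lemma measurable_exp_quad r b : measurable_fun [set: R] (exp_quad r b).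
Proof.
apply: measurableT_comp => //; apply: measurable_funB; first exact: measurable_funM.
by apply: measurable_funM => //; apply: measurable_funM => //; exact: measurable_funX.
Qed.

Lemma measurable_exp_quad_likelihood sigma n m r b :
  measurable_fun [set: tupleR n]
    (fun s => (exp_quad r b (tuple_sum s) * likelihood sigma m s)%:E).
Proof.
apply/measurable_EFinP; apply: measurable_funM; last exact: measurable_likelihood.
exact: (measurableT_comp (measurable_exp_quad _ _) (measurable_tuple_sum n)).
Qed.

Lemma exp_quad_likelihood_ge0 sigma n m r b (s : tupleR n) :
  (0 <= (exp_quad r b (tuple_sum s) * likelihood sigma m s)%:E)%E.
Proof. by rewrite lee_fin mulr_ge0 ?expR_ge0// likelihood_ge0. Qed.

Lemma integral_lebesgue_tuple0 (f : tupleR 0 -> \bar R) :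
  measurable_fun setT f ->
  (\int[lebesgue_tuple R 0]_s f s = f [tuple])%E.
Proof. by move=> mf; rewrite integral_dirac// diracT mul1e. Qed.

(** Tonelli, with the first coordinate integrated out first: in the induction
    below, the sum of the other coordinates is then a fixed shift. *)
Lemma ge0_integral_lebesgue_tupleS n (f : tupleR n.+1 -> \bar R) :
  measurable_fun setT f -> (forall s, (0 <= f s)%E) ->
  (\int[lebesgue_tuple R n.+1]_s f s =
   \int[lebesgue_tuple R n]_s \int[@lebesgue_measure R]_x
     f (tuple_cons (x, s)))%E.
Proof.
move=> mf f0.
rewrite [LHS](_ : _ = \int[pushforward (@lebesgue_measure R \x lebesgue_tuple R n)
   (@tuple_cons _ (measurableTypeR R) n)]_s f s)%E//.
rewrite ge0_integral_pushforward//; last exact: measurable_tuple_cons.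
rewrite preimage_setT fubini_tonelli2//.
  by apply: measurableT_comp => //; exact: measurable_tuple_cons.
by move=> p; exact: f0.
Qed.

(** Under theta = m the sum of the observations is normal with mean n m and
    variance n sigma^2. The induction on n goes through because r and b are
    arbitrary: they change when an observation is integrated out. *)
Lemma integral_exp_quad_likelihood sigma n m r b : 0 < sigma -> 0 <= r ->
  (\int[lebesgue_tuple R n]_s
     (exp_quad r b (tuple_sum s) * likelihood sigma m s)%:E =
   (gauss_exp_quad r b (n%:R * m) (n%:R * sigma ^+ 2))%:E)%E.
Proof.
move=> sigma0; elim: n r b => [|n ih] r b r0.
  rewrite integral_lebesgue_tuple0.
    rewrite /tuple_sum /likelihood !big_ord0 /exp_quad /gauss_exp_quad.
    congr (_%:E).
    by rewrite !mul0r !mulr0 expr0n/= !mulr0 !mul0r subr0 !addr0 subr0 mul0r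
      expR0 sqrtr1 invr1.
  exact: measurable_exp_quad_likelihood.
rewrite ge0_integral_lebesgue_tupleS; first last.
- by move=> s; exact: exp_quad_likelihood_ge0.
- exact: measurable_exp_quad_likelihood.
have v0 : 0 <= sigma ^+ 2 by rewrite sqr_ge0.
have k0 : 0 < 1 + r * sigma ^+ 2 by rewrite ltr_pwDl// mulr_ge0.
transitivity (\int[lebesgue_tuple R n]_s
   ((gauss_exp_quad r b m (sigma ^+ 2))%:E *
    (exp_quad (r / (1 + r * sigma ^+ 2)) ((b - r * m) / (1 + r * sigma ^+ 2))
      (tuple_sum s) * likelihood sigma m s)%:E))%E.
  apply: eq_integral => s _.
  transitivity (\int[@lebesgue_measure R]_x
     ((exp_quad r b (tuple_sum s) * likelihood sigma m s)%:E *
      (exp_quad r (b - r * tuple_sum s) x * normal_pdf m sigma x)%:E))%E.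
    apply: eq_integral => x _.
    rewrite -EFinM; congr (_%:E).
    by rewrite tuple_sum_cons likelihood_cons exp_quadD; ring.
  rewrite ge0_integralZl//=.
  - rewrite integral_exp_quad_normal// -!EFinM; congr (_%:E).
    by rewrite mulrAC exp_quad_gauss// -mulrA.
  - apply/measurable_EFinP; apply: measurable_funM; first exact: measurable_exp_quad.
    exact: measurable_normal_pdf.
  - by move=> x _; rewrite lee_fin mulr_ge0 ?expR_ge0// normal_pdf_ge0.
  - exact: exp_quad_likelihood_ge0.
rewrite ge0_integralZl//=.
- rewrite ih ?divr_ge0 ?(ltW k0)// -EFinM; congr (_%:E).
  rewrite gauss_exp_quad_conv//; last by rewrite mulr_ge0.
  by congr gauss_exp_quad; rewrite -natr1; ring.
- exact: measurable_exp_quad_likelihood.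
- by move=> s _; exact: exp_quad_likelihood_ge0.
- by rewrite lee_fin gauss_exp_quad_ge0.
Qed.

End likelihood_integral.

(** * The posterior density and the closed form of psi *)

Section closed_form.
Context {R : realType}.
Implicit Types (sigma theta : R) (n : nat).
Local Notation tupleR n := (n.-tuple (measurableTypeR R)).

Lemma likelihood_gt0 sigma theta n (s : tupleR n) : 0 < sigma ->
  0 < likelihood sigma theta s.
Proof.
move=> sigma0; apply: prodr_gt0 => i _.
rewrite normal_pdf_expE// mulr_gt0 ?expR_gt0// invr_gt0 sqrtr_gt0.
by rewrite !mulr_gt0 ?pi_gt0// exprn_gt0.
Qed.

(** The data enter the dependence on theta only through their sum: the other
    factor, the likelihood at 0, cancels in the posterior. *)
Lemma likelihood_tilt sigma theta n (s : tupleR n) : 0 < sigma ->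
  likelihood sigma theta s =
  exp_quad (n%:R / sigma ^+ 2) (tuple_sum s / sigma ^+ 2) theta *
  likelihood sigma 0 s.
Proof.
move=> sigma0; elim: n s => [|n ih] s.
  rewrite /likelihood /tuple_sum !big_ord0 /exp_quad.
  by rewrite !mul0r subr0 expR0 mulr1.
rewrite (_ : s = tuple_cons (thead s, [tuple of behead s])); last first.
  by rewrite [LHS]tuple_eta; exact: val_inj.
rewrite !likelihood_cons tuple_sum_cons ih !normal_pdf_expE//.
set L := likelihood _ _ _; set A := (Num.sqrt _)^-1.
set x := thead s; set S := tuple_sum _.
suff E : expR (- (x - theta) ^+ 2 / (2 * sigma ^+ 2)) *
    exp_quad (n%:R / sigma ^+ 2) (S / sigma ^+ 2) theta =
    exp_quad (n.+1%:R / sigma ^+ 2) ((x + S) / sigma ^+ 2) theta *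
    expR (- (x - 0) ^+ 2 / (2 * sigma ^+ 2)).
  by rewrite [LHS]mulrA -[A * _ * _]mulrA E; ring.
rewrite /exp_quad -!expRD; congr expR; rewrite -natr1; field.
by rewrite gt_eqF.
Qed.

Lemma marginal_pdfE sigma n (s : tupleR n) : 0 < sigma ->
  marginal_pdf sigma s = likelihood sigma 0 s *
    gauss_exp_quad (n%:R / sigma ^+ 2) (tuple_sum s / sigma ^+ 2) 0 1.
Proof.
move=> sigma0; rewrite /marginal_pdf /Rintegral.
set r := n%:R / _; set b := tuple_sum s / _.
have r0 : 0 <= r by rewrite divr_ge0// sqr_ge0.
under eq_integral.
  move=> theta _.
  rewrite likelihood_tilt// -/r -/b /prior_pdf mulrAC mulrC EFinM.
  over.
rewrite ge0_integralZl//=.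
- by rewrite integral_exp_quad_normal// expr1n.
- apply/measurable_EFinP; apply: measurable_funM; first exact: measurable_exp_quad.
  exact: measurable_normal_pdf.
- by move=> x _; rewrite lee_fin mulr_ge0 ?expR_ge0// normal_pdf_ge0.
- by rewrite lee_fin likelihood_ge0.
Qed.

Lemma posterior_pdfE sigma theta n (s : tupleR n) : 0 < sigma ->
  posterior_pdf sigma theta s =
  prior_pdf theta * Num.sqrt (1 + n%:R / sigma ^+ 2) *
  expR (- (n%:R * theta ^+ 2 / (2 * sigma ^+ 2))) *
  exp_quad (sigma ^+ 2 * (n%:R + sigma ^+ 2))^-1 (theta / sigma ^+ 2)
    (tuple_sum s).
Proof.
move=> sigma0.
have a0 : 0 < sigma ^+ 2 by rewrite exprn_gt0.
have na0 : 0 < n%:R + sigma ^+ 2 by rewrite ltr_wpDl.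
rewrite /posterior_pdf marginal_pdfE// likelihood_tilt//.
have := @likelihood_gt0 sigma 0 n s sigma0; set L := likelihood _ _ _ => L0.
rewrite /gauss_exp_quad mulr1 !invfM invrK -expRN.
rewrite (_ : forall A B C D : R, A * L * B * (L^-1 * (C * D)) = B * C * (A * D));
  last by move=> *; field; rewrite gt_eqF.
rewrite -[RHS]mulrA; congr (_ * _).
rewrite /exp_quad -!expRD; congr expR; field.
by rewrite !gt_eqF.
Qed.

Lemma psiE sigma theta0 theta1 n : 0 < sigma ->
  psi sigma theta0 theta1 n = psi_expr sigma theta0 theta1 n%:R.
Proof.
move=> sigma0.
have a0 : 0 < sigma ^+ 2 by rewrite exprn_gt0.
have na0 : 0 < n%:R + sigma ^+ 2 by rewrite ltr_wpDl.
have nna0 : 0 < 2 * n%:R + sigma ^+ 2 by rewrite ltr_wpDl// mulr_ge0.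
rewrite /psi /Rintegral.
under eq_integral.
  move=> s _.
  rewrite posterior_pdfE// -mulrA EFinM.
  over.
rewrite ge0_integralZl//=; first last.
- by rewrite lee_fin !mulr_ge0 ?expR_ge0 ?normal_pdf_ge0.
- by move=> s _; exact: exp_quad_likelihood_ge0.
- exact: measurable_exp_quad_likelihood.
rewrite integral_exp_quad_likelihood//= ?invr_ge0 ?mulr_ge0 ?ltW//.
rewrite /gauss_exp_quad /psi_expr /psi_diag_expr /prior_pdf normal_pdf_expE//.
have -> : 1 + (sigma ^+ 2 * (n%:R + sigma ^+ 2))^-1 * (n%:R * sigma ^+ 2) =
  (2 * n%:R + sigma ^+ 2) / (n%:R + sigma ^+ 2).
  by field; rewrite !gt_eqF.
have -> : 1 + n%:R / sigma ^+ 2 = (n%:R + sigma ^+ 2) / sigma ^+ 2.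
  by field; rewrite !gt_eqF.
have p0 : 0 < 2 * pi :> R by rewrite mulr_gt0 ?pi_gt0.
have -> : (n%:R + sigma ^+ 2) /
    (sigma * Num.sqrt (2 * pi * (2 * n%:R + sigma ^+ 2))) =
  (Num.sqrt (2 * pi * 1 ^+ 2))^-1 *
  Num.sqrt ((n%:R + sigma ^+ 2) / sigma ^+ 2) *
  (Num.sqrt ((2 * n%:R + sigma ^+ 2) / (n%:R + sigma ^+ 2)))^-1.
  rewrite expr1n mulr1 !sqrtrM ?sqrtrV ?ltW// sqrtr_sqr gtr0_norm//.
  rewrite -[in LHS](sqr_sqrtr (ltW na0)).
  by field; rewrite !gt_eqF// sqrtr_gt0// ?pi_gt0.
set A := (Num.sqrt _)^-1; set B := Num.sqrt _; set C := (Num.sqrt _)^-1.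
rewrite (_ : forall e1 e2 e3,
  A * e1 * B * e2 * (C * e3) = A * B * C * (e1 * (e2 * e3)));
  last by move=> *; ring.
rewrite (_ : forall e1 e2 e3,
  e1 * (A * B * C * e2) * e3 = A * B * C * (e1 * (e2 * e3)));
  last by move=> *; ring.
rewrite -!expRD; congr (_ * expR _); field.
rewrite !gt_eqF// (_ : 4 * n%:R + _ = 2 * (2 * n%:R + sigma ^+ 2));
  by rewrite ?mulr_gt0//; ring.
Qed.

End closed_form.

(** * Rises and falls of a sequence *)

Section rises_and_falls.
Context {R : realType}.
Implicit Types (I : set nat) (u : nat -> R).

Definition order_convex I := forall m n p, I m -> I p -> (m < n < p)%N -> I n.

Lemma increasing_on_step I u : order_convex I ->
  (forall n, I n -> I n.+1 -> u n <= u n.+1) -> increasing_on I u.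
Proof.
move=> cI uS; apply: homo_leq_in => //; first exact: le_trans.
- by move=> m p /set_mem Im /set_mem Ip n mnp; apply/mem_set; exact: (cI m n p).
- by move=> n /set_mem In /set_mem In1; exact: uS.
Qed.

Lemma decreasing_on_step I u : order_convex I ->
  (forall n, I n -> I n.+1 -> u n.+1 <= u n) -> decreasing_on I u.
Proof.
move=> cI uS; apply: (@homo_leq_in _ _ u (fun x y => y <= x)) => //.
- by move=> y x z xy yz; exact: le_trans yz xy.
- by move=> m p /set_mem Im /set_mem Ip n mnp; apply/mem_set; exact: (cI m n p).
- by move=> n /set_mem In /set_mem In1; exact: uS.
Qed.

(** With l the first rise and m the first fall after l, the sequence falls up
    to l, rises from l to m, and can never rise again after m; the first phase
    is empty when l = 1. *)
Lemma no_rise_fall_rise_type u :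
  (forall i j k, (0 < i)%N -> (i < j)%N -> (j < k)%N ->
     u i < u i.+1 -> u j.+1 < u j -> u k.+1 <= u k) ->
  (forall N, exists2 j, (N < j)%N & u j.+1 < u j) ->
  [\/ decreasing_on [set n : nat | (1 <= n)%N] u,
      exists m : nat, [/\ (1 < m)%N,
        increasing_on [set n : nat | (1 <= n <= m)%N] u &
        decreasing_on [set n : nat | (m <= n)%N] u] |
      exists l m : nat, [/\ (1 < l)%N, (l < m)%N,
        decreasing_on [set n : nat | (1 <= n <= l)%N] u,
        increasing_on [set n : nat | (l <= n <= m)%N] u &
        decreasing_on [set n : nat | (m <= n)%N] u]].
Proof.
move=> pat fall.
have cge a : order_convex [set n : nat | (a <= n)%N].
  by move=> m n p /= am ap /andP[mn _]; exact: leq_trans am (ltnW mn).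
have cin a b : order_convex [set n : nat | (a <= n <= b)%N].
  move=> m n p /= /andP[am _] /andP[_ pb] /andP[mn np].
  by rewrite (leq_trans am (ltnW mn)) (leq_trans (ltnW np) pb).
have [rise|norise] := pselect (exists i, (0 < i)%N && (u i < u i.+1)); last first.
  constructor 1; apply: decreasing_on_step => // n /= n1 _.
  by rewrite leNgt; apply/negP => un; apply: norise; exists n; rewrite n1.
case: (ex_minnP rise) => l /andP[l0 ul] lmin.
have fall_l : exists j, (l < j)%N && (u j.+1 < u j).
  by have [j lj uj] := fall l; exists j; rewrite lj.
case: (ex_minnP fall_l) => m /andP[lm um] mmin.
have dec1 : decreasing_on [set n : nat | (1 <= n <= l)%N] u.
  apply: decreasing_on_step => // n /= /andP[n0 _] nl.
  rewrite leNgt; apply/negP => un.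
  by have := lmin n; rewrite n0 un => /(_ isT); rewrite leqNgt nl.
have inc : increasing_on [set n : nat | (l <= n <= m)%N] u.
  apply: increasing_on_step => // n /= /andP[ln _] /andP[_ nm].
  move: ln; rewrite leq_eqVlt => /predU1P[<-|ln]; first exact: ltW.
  rewrite leNgt; apply/negP => un.
  by have := mmin n; rewrite ln un => /(_ isT); rewrite leqNgt nm.
have dec2 : decreasing_on [set n : nat | (m <= n)%N] u.
  apply: decreasing_on_step => // n /= mn _.
  move: mn; rewrite leq_eqVlt => /predU1P[<-|mn]; first exact: ltW.
  exact: (pat l m n).
move: l0; rewrite leq_eqVlt => /predU1P[l1|l1].
  by constructor 2; exists m; rewrite l1.
by constructor 3; exists l, m.
Qed.

End rises_and_falls.

(** * From the logarithmic derivative to the sequence of values *)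

Section log_derivative.
Context {R : realType}.
Variables f F : R -> R.
Hypothesis f_gt0 : forall t : R, 0 < t -> 0 < f t.
Hypothesis df : forall t : R, 0 < t -> is_derive t 1 f (f t * F t).

Lemma ln_MVT (x y : R) : 0 < x -> x < y ->
  exists2 c, x < c < y & ln (f y) - ln (f x) = F c * (y - x).
Proof.
move=> x0 xy.
have dln (t : R) : 0 < t -> is_derive t 1 (@ln R \o f) (F t).
  move=> t0; apply: is_derive_eq.
    by apply: is_derive1_comp; [exact/is_derive1_ln/f_gt0|exact: df].
  by rewrite mulrA mulVf ?mul1r// gt_eqF ?f_gt0.
have [t||c cxy cE] := @MVT R (@ln R \o f) F x y xy.
- by rewrite in_itv/= => /andP[xt _]; apply: dln; exact: lt_trans xt.
- apply: derivable_within_continuous => t; rewrite in_itv/= => /andP[xt _].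
  by apply: ex_derive; apply: dln; exact: lt_le_trans xt.
- by exists c => //; move: cxy; rewrite in_itv.
Qed.

(** The second difference of ln f is a difference of two increments, to each
    of which the mean value theorem applies. *)
Lemma ln_second_difference (x : R) : 0 < x ->
  exists c d, [/\ x < c, c < d, d < x + 2 &
    ln (f x) + ln (f (x + 2)) - 2 * ln (f (x + 1)) = F d - F c].
Proof.
move=> x0.
have [c /andP[xc cx1] cE] := @ln_MVT x (x + 1) x0 ltac:(lra).
have [d /andP[x1d dx2] dE] := @ln_MVT (x + 1) (x + 2) ltac:(lra) ltac:(lra).
by exists c, d; split=> //; [exact: lt_trans x1d|lra].
Qed.

Lemma ln_product_square (x : R) : 0 < x ->
  [/\ 0 < f x * f (x + 2), 0 < f (x + 1) ^+ 2 &
    ln (f x * f (x + 2)) - ln (f (x + 1) ^+ 2) =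
    ln (f x) + ln (f (x + 2)) - 2 * ln (f (x + 1))].
Proof.
move=> x0.
have f0 : 0 < f x by apply: f_gt0.
have f1 : 0 < f (x + 1) by apply: f_gt0; lra.
have f2 : 0 < f (x + 2) by apply: f_gt0; lra.
split; [exact: mulr_gt0|exact: exprn_gt0|].
by rewrite expr2 !lnM ?posrE//; lra.
Qed.

Lemma log_concave_of_decr (x : R) : 0 < x ->
  (forall s t, x < s -> s < t -> t < x + 2 -> F t < F s) ->
  f x * f (x + 2) < f (x + 1) ^+ 2.
Proof.
move=> x0 decF.
have [c [d [xc cd dx dE]]] := ln_second_difference x x0.
have [p0 q0 E] := ln_product_square x x0.
by rewrite -ltr_ln// -subr_lt0 E dE subr_lt0 decF.
Qed.

Lemma log_convex_of_incr (x : R) : 0 < x ->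
  (forall s t, x < s -> s < t -> t < x + 2 -> F s < F t) ->
  f (x + 1) ^+ 2 < f x * f (x + 2).
Proof.
move=> x0 incF.
have [c [d [xc cd dx dE]]] := ln_second_difference x x0.
have [p0 q0 E] := ln_product_square x x0.
by rewrite -ltr_ln// -subr_gt0 E dE subr_gt0 incF.
Qed.

Lemma rise_score n : (0 < n)%N -> f n%:R < f n.+1%:R ->
  exists2 t, n%:R < t < n.+1%:R & 0 < F t.
Proof.
move=> n0 fn.
have [||t tn tE] := @ln_MVT n%:R n.+1%:R; rewrite ?ltr0n ?ltr_nat//.
exists t => //; move: tE; rewrite -natr1 addrAC subrr add0r mulr1 => <-.
by rewrite subr_gt0 ltr_ln ?posrE ?natr1 ?f_gt0 ?ltr0n.
Qed.

Lemma fall_score n : (0 < n)%N -> f n.+1%:R < f n%:R ->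
  exists2 t, n%:R < t < n.+1%:R & F t < 0.
Proof.
move=> n0 fn.
have [||t tn tE] := @ln_MVT n%:R n.+1%:R; rewrite ?ltr0n ?ltr_nat//.
exists t => //; move: tE; rewrite -natr1 addrAC subrr add0r mulr1 => <-.
by rewrite subr_lt0 ltr_ln ?posrE ?natr1 ?f_gt0 ?ltr0n.
Qed.

Lemma score_neg_fall n : (0 < n)%N ->
  (forall t, n%:R < t -> F t < 0) -> f n.+1%:R < f n%:R.
Proof.
move=> n0 Fn.
have [||t /andP[nt _] tE] := @ln_MVT n%:R n.+1%:R; rewrite ?ltr0n ?ltr_nat//.
rewrite -ltr_ln ?posrE ?f_gt0 ?ltr0n// -subr_lt0 tE.
by rewrite -natr1 addrAC subrr add0r mulr1 Fn.
Qed.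

End log_derivative.

Section unimodal.
Context {R : realType}.
Variables (F : R -> R) (t0 : R).

Definition unimodal_at :=
  (forall s t, 0 < s -> s < t -> t <= t0 -> F s < F t) /\
  (forall s t, 0 < s -> t0 <= s -> s < t -> F t < F s).

Hypothesis uF : unimodal_at.

Lemma unimodal_no_pos_neg_pos x y z : 0 < x -> x < y -> y < z ->
  0 < F x -> F y < 0 -> F z <= 0.
Proof.
move=> x0 xy yz Fx Fy; have [inc dec] := uF.
have [yt|ty] := leP y t0; first by have := inc x y x0 xy yt; lra.
by have := dec y z (lt_trans x0 xy) (ltW ty) yz; lra.
Qed.

(** A strictly monotone function has at most one zero, so the zeros of F are
    told apart by the side of t0 on which they lie. *)
Lemma unimodal_zeros : [set t : R | 0 < t /\ F t = 0] #<= `I_2.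
Proof.
have [inc dec] := uF.
pose side (t : R) : nat := t0 < t.
have inj : {in [set t : R | 0 < t /\ F t = 0] &, injective side}.
  have aux s t : 0 < s -> s < t -> F s = 0 -> F t = 0 -> side s <> side t.
    move=> s0 st Fs Ft; rewrite /side.
    have [tt|tt] := leP t t0; first by exfalso; have := inc s t s0 st tt; lra.
    have [//|ss] := leP s t0.
    by exfalso; have := dec s t s0 (ltW ss) st; lra.
  move=> s t /set_mem[s0 Fs] /set_mem[t0' Ft] st; apply/eqP.
  case: ltgtP => // h; [by have := aux s t s0 h Fs Ft|].
  by have := aux t s t0' h Ft Fs; rewrite st.
rewrite -(card_le_eql (inj_card_eq inj)).
by apply: subset_card_le => _ [t _ <-] /=; rewrite /side; case: (_ < _).
Qed.

End unimodal.

(** * The logarithmic derivative of psi_expr is unimodal *)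

Section score.
Context {R : realType}.
Implicit Types (a theta c t s sigma : R).

(** The logarithmic derivative of psi_expr, for a = sigma^2, theta the mean of
    theta0 and theta1, and c = (theta0 - theta1)^2 / (4 sigma^2). *)
Definition score a theta c t : R :=
  (t + a)^-1 - (2 * t + a)^-1 + theta ^+ 2 * a * (2 * t + a)^-1 ^+ 2 - c.

(** The numerator of the derivative of score a theta c. *)
Definition score_num a theta t : R :=
  (a ^+ 2 - 2 * t ^+ 2) * (2 * t + a) - 4 * theta ^+ 2 * a * (t + a) ^+ 2.

Lemma is_derive_affine (p q t : R) : is_derive t 1 (fun t : R => p * t + q) p.
Proof.
have h : is_derive t 1 ((cst p * id) + cst q) (p *: 1 + t *: 0 + 0).
  by apply: is_deriveD; exact: is_deriveM.
by apply: (is_derive_eq h); rewrite scaler0 !addr0; exact: mulr1.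
Qed.

Lemma is_derive_affineV (p q t : R) : p * t + q != 0 ->
  is_derive t 1 (fun t : R => (p * t + q)^-1) (- p * (p * t + q)^-1 ^+ 2).
Proof.
move=> h.
apply: (is_derive_eq (@is_deriveV _ (fun t : R => p * t + q) t p 1 h
  (is_derive_affine p q t))).
by rewrite exprVn [RHS]mulrC mulrN -mulNr.
Qed.

Lemma is_derive_score a theta c t : 0 < a -> 0 < t ->
  is_derive t 1 (score a theta c)
    (score_num a theta t / ((t + a) ^+ 2 * (2 * t + a) ^+ 3)).
Proof.
move=> a0 t0.
have ta : 0 < t + a by rewrite addr_gt0.
have tta : 0 < 2 * t + a by rewrite addr_gt0// mulr_gt0.
have h1 : is_derive t 1 (fun t => (t + a)^-1) (- (t + a)^-1 ^+ 2).
  have := @is_derive_affineV 1 a t; rewrite mul1r gt_eqF// => /(_ isT).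
  rewrite mulN1r; congr is_derive.
  by apply/funext => x; rewrite mul1r.
have h2 := @is_derive_affineV 2 a t (lt0r_neq0 tta).
have h := is_deriveB (is_deriveD (is_deriveB h1 h2)
  (is_deriveM (is_derive_cst (theta ^+ 2 * a) t 1) (is_deriveX 2 h2)))
  (is_derive_cst c t 1).
apply: (is_derive_eq h); rewrite /cst/= /score_num !scaler0 /GRing.scale/=.
by field; rewrite !gt_eqF.
Qed.

Lemma score_MVT a theta c s t : 0 < a -> 0 < s -> s < t ->
  exists2 r, s < r < t & exists2 k, 0 < k &
    score a theta c t - score a theta c s = k * score_num a theta r.
Proof.
move=> a0 s0 st.
have dscore r : s <= r -> is_derive r 1 (score a theta c)
    (score_num a theta r / ((r + a) ^+ 2 * (2 * r + a) ^+ 3)).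
  by move=> sr; apply: is_derive_score => //; exact: lt_le_trans sr.
have [r||r] := MVT (f := score a theta c) (df := fun r =>
  score_num a theta r / ((r + a) ^+ 2 * (2 * r + a) ^+ 3)) st.
- by rewrite in_itv/= => /andP[sr _]; exact/dscore/ltW.
- apply: derivable_within_continuous => r; rewrite in_itv/= => /andP[sr _].
  by apply: ex_derive; exact: dscore.
rewrite in_itv/= => str E; exists r => //.
have r0 : 0 < r by move: str => /andP[sr _]; exact: lt_trans sr.
exists ((t - s) / ((r + a) ^+ 2 * (2 * r + a) ^+ 3)).
  by rewrite divr_gt0 ?subr_gt0// mulr_gt0// exprn_gt0//; lra.
by rewrite E mulrC mulrCA mulrC.
Qed.

Lemma score_incr a theta c s t : 0 < a -> 0 < s -> s < t ->
  (forall r, s < r < t -> 0 < score_num a theta r) ->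
  score a theta c s < score a theta c t.
Proof.
move=> a0 s0 st npos.
have [r str [k k0 E]] := score_MVT a theta c s t a0 s0 st.
by rewrite -subr_gt0 E mulr_gt0 ?npos.
Qed.

Lemma score_decr a theta c s t : 0 < a -> 0 < s -> s < t ->
  (forall r, s < r < t -> score_num a theta r < 0) ->
  score a theta c t < score a theta c s.
Proof.
move=> a0 s0 st nneg.
have [r str [k k0 E]] := score_MVT a theta c s t a0 s0 st.
by rewrite -subr_lt0 E pmulr_rlt0 ?nneg.
Qed.

(** The condition on theta makes every coefficient of the cubic nonpositive. *)
Lemma score_num_lt0_of_theta a theta t : 0 < a -> 0 < t -> 1 / 2 <= `|theta| ->
  score_num a theta t < 0.
Proof.
move=> a0 t0 th.
have th2 : 1 / 4 <= theta ^+ 2.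
  by rewrite -(real_normK (num_real theta)); move: `|theta| th => n; nra.
rewrite /score_num.
have h : 1 * (a * (t + a) ^+ 2) <= 4 * theta ^+ 2 * (a * (t + a) ^+ 2).
  by rewrite ler_wpM2r ?mulr_ge0 ?sqr_ge0 ?(ltW a0)//; lra.
have -> : 4 * theta ^+ 2 * a * (t + a) ^+ 2 =
  4 * theta ^+ 2 * (a * (t + a) ^+ 2) by ring.
have at2 : 0 < a * t ^+ 2 by rewrite mulr_gt0// exprn_gt0.
have t3 : 0 < t ^+ 3 by rewrite exprn_gt0.
by lra.
Qed.

Lemma score_num_lt0_of_t a theta t : 0 < a -> 0 < t -> a ^+ 2 < 2 * t ^+ 2 ->
  score_num a theta t < 0.
Proof.
move=> a0 t0 at2; rewrite /score_num subr_lt0 (@lt_le_trans _ _ 0)//.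
  by rewrite pmulr_llt0 ?subr_lt0//; lra.
by rewrite mulr_ge0 ?sqr_ge0// mulr_ge0 ?(ltW a0)// mulr_ge0 ?sqr_ge0.
Qed.

(** Descartes' rule for the cubic: it is A + B t - C t^2 - D t^3 with A and B
    of the sign of 1 - 4 theta^2 and C, D > 0, so that its quotient by t
    decreases when A >= 0; hence it has at most one positive root. *)
Lemma score_num_sign_change a theta s t : 0 < a -> 0 < s -> s < t ->
  4 * theta ^+ 2 <= 1 -> s * score_num a theta t < t * score_num a theta s.
Proof.
move=> a0 s0 st th; rewrite -subr_gt0.
rewrite [X in 0 < X](_ : _ = (t - s) * (a ^+ 3 * (1 - 4 * theta ^+ 2) +
   s * t * (2 * a * (1 + 2 * theta ^+ 2)) + 4 * s * t * (s + t)));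
  last by rewrite /score_num; ring.
have t0 := lt_trans s0 st.
rewrite mulr_gt0 ?subr_gt0// ltr_wpDl//.
  have a3 : 0 <= a ^+ 3 by rewrite exprn_ge0// ltW.
  have th0 := sqr_ge0 theta.
  by rewrite addr_ge0// !mulr_ge0 ?(ltW a0) ?(ltW s0) ?(ltW t0)//; lra.
by rewrite !mulr_gt0// addr_gt0.
Qed.

Lemma score_num_root a theta : 0 < a -> `|theta| < 1 / 2 ->
  exists2 t0, 0 < t0 & score_num a theta t0 = 0.
Proof.
move=> a0 th.
have th2 : 4 * theta ^+ 2 < 1.
  rewrite -(real_normK (num_real theta)); have := normr_ge0 theta.
  by move: `|theta| th => n; nra.
pose p : {poly R} := ((a ^+ 2)%:P - 2%:P * 'X ^+ 2) * (2%:P * 'X + a%:P) -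
  (4 * theta ^+ 2 * a)%:P * ('X + a%:P) ^+ 2.
have pE x : p.[x] = score_num a theta x by rewrite /p /score_num !hornerE.
have p0 : 0 < p.[0].
  rewrite pE /score_num (_ : _ - _ = a ^+ 3 * (1 - 4 * theta ^+ 2));
    last by ring.
  by rewrite mulr_gt0 ?exprn_gt0// subr_gt0.
have pa : p.[a] <= 0.
  rewrite pE /score_num (_ : _ - _ = - (a ^+ 3 * (3 + 16 * theta ^+ 2)));
    last by ring.
  by rewrite oppr_le0 mulr_ge0 ?exprn_ge0 ?ltW// ltr_wpDr// mulr_ge0 ?sqr_ge0.
have [|x] := @poly_ivt _ (- p) 0 a (ltW a0).
  by rewrite !hornerN oppr_le0 oppr_ge0 (ltW p0).
move=> /andP[x0 _]; rewrite rootE hornerN oppr_eq0 => /eqP px.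
exists x; last by rewrite -pE.
by rewrite lt_neqAle x0 andbT; apply: contraTneq p0 => xE; rewrite {2}xE px ltxx.
Qed.

(** The turning point does not depend on c, that is, on theta0 - theta1: one
    threshold serves all pairs with the same mean. *)
Lemma score_unimodal a theta : 0 < a ->
  exists2 t0, 0 <= t0 & forall c, unimodal_at (score a theta c) t0.
Proof.
move=> a0; have [th|th] := leP (1 / 2) `|theta|.
  exists 0 => // c; split => [s t s0 st t0|s t s0 _ st]; first by exfalso; lra.
  apply: score_decr => // r /andP[sr _].
  by apply: score_num_lt0_of_theta => //; exact: lt_trans sr.
have [t0 t00 nt0] := @score_num_root a theta a0 th.
have th2 : 4 * theta ^+ 2 <= 1.
  rewrite -(real_normK (num_real theta)); have := normr_ge0 theta.
  by move: `|theta| th => n; nra.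
exists t0; first exact: ltW.
move=> c; split => [s t s0 st tt0|s t s0 t0s st].
- apply: score_incr => // r /andP[sr rt].
  have r0 := lt_trans s0 sr.
  have := @score_num_sign_change a theta r t0 a0 r0 (lt_le_trans rt tt0) th2.
  by rewrite nt0 mulr0 pmulr_rgt0.
- apply: score_decr => // r /andP[sr rt].
  have := @score_num_sign_change a theta t0 r a0 t00 (le_lt_trans t0s sr) th2.
  by rewrite nt0 mulr0 pmulr_rlt0.
Qed.

(** For t > 1 the score is below (1 + theta^2 a) / t - c. *)
Lemma score_eventually_neg a theta c : 0 < a -> 0 < c ->
  exists t0, forall t, t0 < t -> score a theta c t < 0.
Proof.
move=> a0 c0; exists (Num.max 1 ((1 + theta ^+ 2 * a) / c)) => t.
rewrite gt_max => /andP[t1]; rewrite ltr_pdivrMr// => tc.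
have t0 : 0 < t by lra.
have ta : 0 < t + a by rewrite addr_gt0.
have tta : 0 < 2 * t + a by rewrite addr_gt0// mulr_gt0.
rewrite /score subr_lt0.
have h1 : (t + a)^-1 <= t^-1 by rewrite lef_pV2 ?posrE//; lra.
have h2 : 0 < (2 * t + a)^-1 by rewrite invr_gt0.
have h3 : (2 * t + a)^-1 ^+ 2 <= t^-1.
  rewrite exprVn lef_pV2 ?posrE ?exprn_gt0//; nra.
have h4 : theta ^+ 2 * a * (2 * t + a)^-1 ^+ 2 <= theta ^+ 2 * a * t^-1.
  by rewrite ler_wpM2l// mulr_ge0 ?sqr_ge0// ltW.
have h5 : t^-1 + theta ^+ 2 * a * t^-1 < c.
  by rewrite -[X in X + _]mul1r -mulrDl ltr_pdivrMr// [c * t]mulrC.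
lra.
Qed.

End score.

(** * The logarithmic derivative of psi_expr *)

Section psi_expr.
Context {R : realType}.
Implicit Types (k a theta t sigma : R).

Lemma psi_expr_gt0 sigma theta0 theta1 t : 0 < sigma -> 0 <= t ->
  0 < psi_expr sigma theta0 theta1 t.
Proof.
move=> sigma0 t0; have a0 : 0 < sigma ^+ 2 by rewrite exprn_gt0.
have ta : 0 < t + sigma ^+ 2 by rewrite ltr_wpDl.
have tta : 0 < 2 * t + sigma ^+ 2 by rewrite ltr_wpDl// mulr_ge0.
by rewrite /psi_expr /psi_diag_expr !mulr_gt0 ?expR_gt0// invr_gt0
  mulr_gt0// sqrtr_gt0 !mulr_gt0 ?pi_gt0.
Qed.

(** With S = Num.sqrt (k * (2 * t + a)), the identity S^2 = k (2 t + a) makes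
    the derivative of 1 / S a rational multiple of 1 / S. *)
Lemma is_derive_sqrt_affineV sigma k a t :
  0 < sigma -> 0 < k -> 0 < 2 * t + a ->
  is_derive t 1 (fun t : R => (sigma * Num.sqrt (k * (2 * t + a)))^-1)
    (- (sigma * Num.sqrt (k * (2 * t + a)))^-1 / (2 * t + a)).
Proof.
move=> sigma0 k0 tta.
have S0 : 0 < Num.sqrt (k * (2 * t + a)) by rewrite sqrtr_gt0 mulr_gt0.
have S2 : Num.sqrt (k * (2 * t + a)) ^+ 2 = k * (2 * t + a).
  by rewrite sqr_sqrtr// mulr_ge0// ltW.
have h1 : is_derive t 1 (fun t : R => k * (2 * t + a)) (k * 2).
  have h := @is_derive_affine R (k * 2) (k * a) t.
  by congr is_derive : h; apply/funext => x; ring.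
have h2 := @is_derive1_comp R Num.sqrt _ t _ _
  (is_derive1_sqrt (mulr_gt0 k0 tta)) h1.
have h3 := is_deriveM (is_derive_cst sigma t 1) h2.
have N0 : ((cst sigma : R -> R) *
    (Num.sqrt \o (fun t : R => k * (2 * t + a)))) t != 0.
  by rewrite mulf_neq0//= gt_eqF.
apply: (is_derive_eq (is_deriveV N0 h3)).
rewrite /cst /= !scaler0 addr0 /GRing.scale/= mulrfctE/=.
move: S0 S2; set S := Num.sqrt _ => S0 S2.
have -> : 2 * t + a = S ^+ 2 / k by rewrite S2; field; rewrite gt_eqF.
by field; rewrite !gt_eqF.
Qed.

Lemma is_derive_psi_expr sigma theta0 theta1 t : 0 < sigma -> 0 < t ->
  is_derive t 1 (psi_expr sigma theta0 theta1)
    (psi_expr sigma theta0 theta1 t *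
     score (sigma ^+ 2) ((theta0 + theta1) / 2)
       ((theta0 - theta1) ^+ 2 / (4 * sigma ^+ 2)) t).
Proof.
move=> sigma0 t0; have a0 : 0 < sigma ^+ 2 by rewrite exprn_gt0.
set theta := (theta0 + theta1) / 2; set a := sigma ^+ 2 in a0 *.
have ta : 0 < t + a by rewrite addr_gt0.
have tta : 0 < 2 * t + a by rewrite addr_gt0// mulr_gt0.
have p0 : 0 < 2 * pi :> R by rewrite mulr_gt0 ?pi_gt0.
have S0 : 0 < Num.sqrt (2 * pi * (2 * t + a)) by rewrite sqrtr_gt0 mulr_gt0.
have hS := @is_derive_sqrt_affineV sigma (2 * pi) a t sigma0 p0 tta.
have hA : is_derive t 1 (fun t : R => t + a) 1.
  have h := @is_derive_affine R 1 a t.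
  by congr is_derive : h; apply/funext => x; rewrite mul1r.
have hE1 : is_derive t 1
    (fun t : R => expR (- (theta ^+ 2 * a / (4 * t + 2 * a))))
    (expR (- (theta ^+ 2 * a / (4 * t + 2 * a))) *
      (theta ^+ 2 * a * (2 * t + a)^-1 ^+ 2)).
  have N0 : 4 * t + 2 * a != 0 by rewrite gt_eqF//; lra.
  have h1 := is_deriveN (is_deriveM (is_derive_cst (theta ^+ 2 * a) t 1)
    (@is_derive_affineV R 4 (2 * a) t N0)).
  have h2 := @is_derive1_comp R expR _ t _ _ (is_derive_expR _) h1.
  apply: (is_derive_eq h2); rewrite /cst /= !scaler0 addr0 /GRing.scale/=.
  congr (_ * _); field.
  by rewrite N0 gt_eqF.
have hE2 : is_derive t 1
    (fun t : R => expR (- (t * (theta0 - theta1) ^+ 2 / (4 * a))))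
    (expR (- (t * (theta0 - theta1) ^+ 2 / (4 * a))) *
      - ((theta0 - theta1) ^+ 2 / (4 * a))).
  have h1 : is_derive t 1 (fun t : R => - (t * (theta0 - theta1) ^+ 2 / (4 * a)))
    (- ((theta0 - theta1) ^+ 2 / (4 * a))).
    have h := @is_derive_affine R (- ((theta0 - theta1) ^+ 2 / (4 * a))) 0 t.
    by congr is_derive : h; apply/funext => x; field; rewrite gt_eqF.
  exact: (@is_derive1_comp R expR _ t _ _ (is_derive_expR _) h1).
have h := is_deriveM (is_deriveM
   (is_derive_cst (expR ((theta ^+ 2 - theta0 ^+ 2) / 2)) t 1)
   (is_deriveM (is_deriveM hA hS) hE1)) hE2.
apply: (is_derive_eq h).
rewrite /cst/= !mulrfctE /= !scaler0 /GRing.scale/= /psi_expr /psi_diag_expr.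
rewrite -/theta -/a /score.
set E1 := expR _; set E2 := expR _; set E3 := expR _; set S := Num.sqrt _.
by field; rewrite !gt_eqF.
Qed.

End psi_expr.

(** * The shape of psi *)

Section psi_shape.
Context {R : realType}.
Variables (sigma : R) (theta0 theta1 : R).
Hypothesis sigma_gt0 : 0 < sigma.

Let f := psi_expr sigma theta0 theta1.
Let a := sigma ^+ 2.
Let c := (theta0 - theta1) ^+ 2 / (4 * sigma ^+ 2).
Let F := score a ((theta0 + theta1) / 2) c.

Let f_gt0 (t : R) : 0 < t -> 0 < f t.
Proof. by move=> t0; apply: psi_expr_gt0 => //; exact: ltW. Qed.

Let df (t : R) : 0 < t -> is_derive t 1 f (f t * F t).
Proof. exact: is_derive_psi_expr. Qed.

Lemma psi_strictly_log_convex_on (I : set nat) :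
  (forall n, I n -> (0 < n)%N) ->
  (forall n (s t : R), I n -> I n.+2 ->
     n%:R < s -> s < t -> t < n.+2%:R -> F s < F t) ->
  strictly_log_convex_on I (psi sigma theta0 theta1).
Proof.
move=> I0 incF; split => [n In|n In _ In2]; rewrite !psiE//.
  by apply: f_gt0; rewrite ltr0n I0.
rewrite -[n.+2]addn2 -[n.+1]addn1 !natrD.
apply: (@log_convex_of_incr _ f F) => //; first by rewrite ltr0n I0.
by move=> s t ns st tn; apply: (incF n) => //; rewrite -addn2 natrD.
Qed.

Lemma psi_strictly_log_concave_on (I : set nat) :
  (forall n, I n -> (0 < n)%N) ->
  (forall n (s t : R), I n -> n%:R < s -> s < t -> F t < F s) ->
  strictly_log_concave_on I (psi sigma theta0 theta1).
Proof.
move=> I0 decF; split => [n In|n In _ In2]; rewrite !psiE//.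
  by apply: f_gt0; rewrite ltr0n I0.
rewrite -[n.+2]addn2 -[n.+1]addn1 !natrD.
apply: (@log_concave_of_decr _ f F) => //; first by rewrite ltr0n I0.
by move=> s t ns st _; exact: (decF n).
Qed.

Lemma psi_expr_derivable (t : R) : 0 < t -> derivable f t 1.
Proof. by move=> t0; case: (df t t0). Qed.

Lemma psi_expr_critical :
  [set t : R | 0 < t /\ derive1 f t = 0] = [set t | 0 < t /\ F t = 0].
Proof.
apply/seteqP; split => t /= [t0].
- rewrite derive1E; have [_ ->] := df t t0.
  move=> /eqP; rewrite mulf_eq0 gt_eqF ?f_gt0//= => /eqP; by split.
- move=> Ft; split=> //; rewrite derive1E; have [_ ->] := df t t0.
  by rewrite Ft mulr0.
Qed.

(** Each rise or fall between consecutive indices yields, by the mean value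
    theorem, a point between them where the score has the matching sign. *)
Lemma psi_no_rise_fall_rise (t0 : R) i j k : unimodal_at F t0 ->
  (0 < i)%N -> (i < j)%N -> (j < k)%N ->
  psi sigma theta0 theta1 i < psi sigma theta0 theta1 i.+1 ->
  psi sigma theta0 theta1 j.+1 < psi sigma theta0 theta1 j ->
  psi sigma theta0 theta1 k.+1 <= psi sigma theta0 theta1 k.
Proof.
move=> uF i0 ij jk; rewrite !psiE// => ui uj.
rewrite leNgt; apply/negP => uk.
have j0 := leq_trans i0 (ltnW ij); have k0 := leq_trans j0 (ltnW jk).
have [x /andP[ix xi] Fx] := rise_score f F f_gt0 df i i0 ui.
have [y /andP[jy yj] Fy] := fall_score f F f_gt0 df j j0 uj.
have [z /andP[kz zk] Fz] := rise_score f F f_gt0 df k k0 uk.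
have x0 : 0 < x by exact: le_lt_trans (ler0n _ _) ix.
have xy : x < y by apply: lt_trans xi _; apply: le_lt_trans jy; rewrite ler_nat.
have yz : y < z by apply: lt_trans yj _; apply: le_lt_trans kz; rewrite ler_nat.
by have := unimodal_no_pos_neg_pos F t0 uF x y z x0 xy yz Fx Fy; rewrite leNgt Fz.
Qed.

Lemma psi_falls_cofinally : theta1 != theta0 -> forall N, exists2 j,
  (N < j)%N & psi sigma theta0 theta1 j.+1 < psi sigma theta0 theta1 j.
Proof.
move=> th N.
have a0 : 0 < a by rewrite exprn_gt0.
have c0 : 0 < c.
  by rewrite divr_gt0 ?(mulr_gt0 _ a0)// exprn_even_gt0//= subr_eq0 eq_sym.
have [b Fneg] := score_eventually_neg a ((theta0 + theta1) / 2) c a0 c0.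
pose j := (maxn N (Num.truncn b).+1).+1.
have bj : b < j%:R.
  by apply: lt_le_trans (truncnS_gt b) _; rewrite ler_nat /j ltnW// ltnS leq_maxr.
exists j; first by rewrite ltnS leq_maxl.
rewrite !psiE//; apply: (score_neg_fall f F f_gt0 df) => // t jt.
by apply: Fneg; exact: lt_trans jt.
Qed.

End psi_shape.

Theorem theorem4 (R : realType) (sigma : R) (sigma_gt0 : 0 < sigma) :
  (* (i) *)
  (forall (theta : R) (n : nat), (1 <= n)%N ->
     psi sigma theta theta n = psi_diag_expr sigma theta n%:R /\
     forall theta0 theta1 : R, (theta0 + theta1) / 2 = theta ->
       psi sigma theta0 theta1 n =
         expR ((theta ^+ 2 - theta0 ^+ 2) / 2) * psi sigma theta theta n *
         expR (- (n%:R * (theta0 - theta1) ^+ 2 / (4 * sigma ^+ 2)))) /\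
  (* (ii) *)
  (forall theta : R, exists n0 : R, 0 <= n0 /\
     let before := [set n : nat | (1 <= n)%N /\ n%:R < n0] in
     let after := [set n : nat | (1 <= n)%N /\ n0 < n%:R] in
     [/\ strictly_log_convex_on before (psi sigma theta theta),
         strictly_log_concave_on after (psi sigma theta theta) &
         forall theta0 theta1 : R, (theta0 + theta1) / 2 = theta ->
           strictly_log_convex_on before (psi sigma theta0 theta1) /\
           strictly_log_concave_on after (psi sigma theta0 theta1)]) /\
  (* (iii) *)
  (forall theta : R, sigma ^+ 2 <= Num.sqrt 2 \/ 1 / 2 <= `|theta| ->
     strictly_log_concave_on [set n : nat | (1 <= n)%N]
       (psi sigma theta theta)) /\
  (* (iv) *)
  (forall theta0 theta1 : R, theta1 != theta0 ->
     let f := psi_expr sigma theta0 theta1 in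
     let u := psi sigma theta0 theta1 in
     [/\ forall t : R, 0 < t -> derivable f t 1,
         [set t : R | 0 < t /\ derive1 f t = 0] #<= `I_2 &
         [\/ decreasing_on [set n : nat | (1 <= n)%N] u,
             exists m : nat, [/\ (1 < m)%N,
               increasing_on [set n : nat | (1 <= n <= m)%N] u &
               decreasing_on [set n : nat | (m <= n)%N] u] |
             exists l m : nat, [/\ (1 < l)%N, (l < m)%N,
               decreasing_on [set n : nat | (1 <= n <= l)%N] u,
               increasing_on [set n : nat | (l <= n <= m)%N] u &
               decreasing_on [set n : nat | (m <= n)%N] u]]]).
Proof.
have a0 : 0 < sigma ^+ 2 by rewrite exprn_gt0.
have diag (theta : R) : (theta + theta) / 2 = theta by field.
split; [|split; [|split]].
- move=> theta n _.
  have psi_diag : psi sigma theta theta n = psi_diag_expr sigma theta n%:R.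
    rewrite psiE// /psi_expr diag !subrr mul0r expR0 mul1r expr0n/=.
    by rewrite mulr0 mul0r oppr0 expR0 mulr1.
  split=> // theta0 theta1 th.
  by rewrite psi_diag psiE// /psi_expr th.
- move=> theta; have [n0 n00 uF] := @score_unimodal _ (sigma ^+ 2) theta a0.
  exists n0; split => // before after.
  have shape (theta0 theta1 : R) : (theta0 + theta1) / 2 = theta ->
      strictly_log_convex_on before (psi sigma theta0 theta1) /\
      strictly_log_concave_on after (psi sigma theta0 theta1).
    move=> th; split.
    + apply: psi_strictly_log_convex_on => //; first by move=> n [].
      move=> n s t [n1 _] [_ nn0] ns st tn; rewrite th.
      apply: (uF _).1 => //; first exact: le_lt_trans ns.
      exact: ltW (lt_trans tn nn0).
    + apply: psi_strictly_log_concave_on => //; first by move=> n [].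
      move=> n s t [n1 nn0] ns st; rewrite th.
      apply: (uF _).2 => //; first exact: le_lt_trans ns.
      exact: ltW (lt_trans nn0 ns).
  by split=> //; have [] := shape theta theta (diag theta).
- move=> theta h; apply: psi_strictly_log_concave_on => // n s t n1 ns st.
  have s1 : 1 < s by apply: le_lt_trans ns; rewrite ler1n.
  rewrite diag; apply: score_decr => //; first exact: lt_trans s1.
  move=> r /andP[sr rt]; have r1 := lt_trans s1 sr.
  case: h => [h|h]; last by apply: score_num_lt0_of_theta => //; exact: lt_trans r1.
  apply: score_num_lt0_of_t => //; first exact: lt_trans r1.
  have : (sigma ^+ 2) ^+ 2 <= 2.
    rewrite -[leRHS](@sqr_sqrtr _ (2 : R))//.
    by rewrite lerXn2r ?nnegrE ?sqrtr_ge0// ltW.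
  by move=> /le_lt_trans; apply; nra.
- move=> theta0 theta1 th f u.
  have [t0 _ uF] := @score_unimodal _ (sigma ^+ 2) ((theta0 + theta1) / 2) a0.
  split.
  + by move=> t t_gt0; exact: psi_expr_derivable.
  + by rewrite psi_expr_critical//; exact: unimodal_zeros _ _ (uF _).
  + apply: no_rise_fall_rise_type.
      by move=> i j k; apply: (psi_no_rise_fall_rise _ _ _ sigma_gt0 t0 i j k (uF _)).
    exact: psi_falls_cofinally.
Qed.
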